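(* Let $n\ge4$ and let $2\le k\le\lfloor n/2\rfloor$ be an integer. If $k\ge\frac n3$, then $F_k$ is the face of the F-simplex spanned by $p_k,p_{k+1},\dots,p_{\lfloor n/2\rfloor}$. This bound is tight: for every $n\ge7$, if $k$ is the largest integer with $k<\frac n3$, then $F_k$ is not equal to the face of the F-simplex spanned by $p_k,\dots,p_{\lfloor n/2\rfloor}$.
   Context: $\overline{M}_{0,n}$ is the moduli space of stable $n$-pointed genus $0$ curves. For $2\le j\le\lfloor n/2\rfloor$, $D_j$ is the boundary divisor parameterizing curves with a node separating $j$ marked points from the other $n-j$. The $D_j$ form a basis of the space of $\mathfrak{S}_n$-invariant $\mathbb{Q}$-divisor classes; write such a class as $\sum_{j=2}^{\lfloor n/2\rfloor}r_jD_j$, and set $r_1=0$ and $r_{n-j}=r_j$. Let $W=\mathbb{P}(\mathbb{Q}^{\lfloor n/2\rfloor-1})$ be the projectivization of this space, with coordinates $(r_2,\dots,r_{\lfloor n/2\rfloor})$. Let $F\subset W$ be the (projectivized) cone of F-nef divisors, i.e. those meeting every vital curve nonnegatively (a vital curve is an irreducible component of the locus of curves with at least $n-4$ nodes); explicitly $F$ is given by the inequalities $$r_{a+b}+r_{a+c}+r_{a+d}-r_a-r_b-r_c-r_d\ge0$$ for all partitions $a+b+c+d=n$ into positive integers. For $1\le i\le\lfloor n/2\rfloor-1$, $V_i\subset W$ is the hyperplane corresponding to the partition $1+1+i+(n-i-2)=n$, i.e. $r_2+2r_{i+1}-r_i-r_{i+2}=0$. For $2\le k\le\lfloor n/2\rfloor$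 set $F_k=V_1\cap\dots\cap V_{k-2}\cap F$ (so $F_2=F$). The F-simplex is the simplex in $W$ induced by $V_1,\dots,V_{\lfloor n/2\rfloor-1}$, i.e. the projectivization of the cone $\{r_2+2r_{i+1}-r_i-r_{i+2}\ge0,\ 1\le i\le\lfloor n/2\rfloor-1\}$ (the defining linear forms are linearly independent). Its vertices are $p_{k}:=\bigcap_{i\ne k-1}V_i$, $2\le k\le\lfloor n/2\rfloor$ (the intersection over $1\le i\le\lfloor n/2\rfloor-1$, $i\neq k-1$). Faces and spans are taken projectively, i.e. for the corresponding cones in $\mathbb{Q}^{\lfloor n/2\rfloor-1}$. *)

(* Defs.v *)
From HB Require Import structures.
From mathcomp Require Import all_boot all_order all_algebra.
From mathcomp Require Import zify ring lra.
From mathcomp Require Import boolp classical_sets.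

Set Implicit Arguments.
Unset Strict Implicit.
Unset Printing Implicit Defensive.

Import Order.TTheory GRing.Theory Num.Theory.

Local Open Scope classical_set_scope.
Local Open Scope ring_scope.

(* A class sum_(2 <= j <= n/2) r_j D_j is the row vector of its coordinates in
   the basis (D_j); entry number i holds r_(i+2). *)
Definition divClass (n : nat) := 'rV[rat]_(n./2.-1).

(* r_j for 1 <= j <= n-1, with the conventions r_1 = 0 and r_(n-j) = r_j.
   Only values of j in that range are ever used. *)
Definition coef (n : nat) (r : divClass n) (j : nat) : rat :=
  if minn j (n - j) is i.+2 then oapp (r ord0) 0 (insub i) else 0.

(* W = P(Q^(n/2 - 1)): its points are the lines of the vector space. *)
Definition W (n : nat) := {L : {vspace divClass n} | \dim L == 1%N}.

Definition line (n : nat) (L : W n) : {vspace divClass n} := sval L.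

Definition proj (n : nat) (C : set (divClass n)) : set (W n) :=
  [set L | exists r, [/\ C r, r != 0 & r \in line L]].

(* Intersection number with the vital curves of type (a,b,c,d). *)
Definition Fform (n : nat) (a b c d : nat) (r : divClass n) : rat :=
  coef r (a + b) + coef r (a + c) + coef r (a + d)
  - coef r a - coef r b - coef r c - coef r d.

Definition Fcone (n : nat) : set (divClass n) :=
  [set r | forall a b c d : nat,
     (0 < a)%N -> (0 < b)%N -> (0 < c)%N -> (0 < d)%N ->
     (a + b + c + d = n)%N -> 0 <= Fform a b c d r].
Arguments Fcone : clear implicits.

Definition F (n : nat) : set (W n) := proj (Fcone n).
Arguments F : clear implicits.

Definition Vform (n i : nat) (r : divClass n) : rat :=
  coef r 2 + 2 * coef r i.+1 - coef r i - coef r i.+2.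

Lemma VformE (n i : nat) (r : divClass n) :
  (1 <= i <= n./2.-1)%N -> Vform i r = Fform 1 1 i (n - i - 2) r.
Proof.
move=> hi; rewrite /Vform /Fform.
have coef_sym j : (j <= n)%N -> coef r (n - j) = coef r j.
  by move=> le_jn; rewrite /coef subKn // minnC.
have coef1 : coef r 1 = 0 by rewrite /coef; case: (minn 1 _) (geq_minl 1 (n - 1)) => [|[]].
rewrite -(coef_sym i.+1) -?(coef_sym i.+2); [|lia..].
have -> : (n - i.+1 = 1 + (n - i - 2))%N by lia.
have -> : (n - i.+2 = n - i - 2)%N by lia.
have <- : coef r (1 + i) = coef r (1 + (n - i - 2)).
  by rewrite -(coef_sym (1 + i)%N); [congr coef|]; lia.
rewrite coef1 addnn; ring.
Qed.

Definition V (n i : nat) : set (W n) :=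
  proj [set r : divClass n | Vform i r = 0].
Arguments V : clear implicits.

Definition F_ (n k : nat) : set (W n) :=
  (\bigcap_(i in [set i : nat | (1 <= i <= k - 2)%N]) V n i) `&` F n.
Arguments F_ : clear implicits.

Definition Fsimplex_cone (n : nat) : set (divClass n) :=
  [set r | forall i : nat, (1 <= i <= n./2.-1)%N -> 0 <= Vform i r].
Arguments Fsimplex_cone : clear implicits.

(* The vertex p_k, as a subset of W; it is a single point for
   2 <= k <= n/2. *)
Definition vertex (n k : nat) : set (W n) :=
  \bigcap_(i in [set i : nat | (1 <= i <= n./2.-1)%N /\ i <> k.-1]) V n i.
Arguments vertex : clear implicits.

Definition cone_hull (n : nat) (A : set (divClass n)) : set (divClass n) :=
  [set r | exists (m : nat) (c : 'I_m -> rat) (v : 'I_m -> divClass n),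
     [/\ forall i, 0 <= c i, forall i, A (v i) & r = \sum_i c i *: v i]].

(* The convex span of a set P of points of W that lie in the F-simplex.
   Convexity needs a choice of half-line on each of the lines in P: it is the
   half-line contained in the cone over the F-simplex. *)
Definition Fsimplex_span (n : nat) (P : set (W n)) : set (W n) :=
  proj (cone_hull [set r | Fsimplex_cone n r /\ exists2 L, P L & r \in line L]).

(* The face of the F-simplex spanned by p_k, p_(k+1), ..., p_(n/2). *)
Definition Fsimplex_face (n k : nat) : set (W n) :=
  Fsimplex_span
    (\bigcup_(j in [set j : nat | (k <= j <= n./2)%N]) vertex n j).
Arguments Fsimplex_face : clear implicits.

(* Main.v *)
Require Import Defs.
From HB Require Import structures.
From mathcomp Require Import all_boot all_order all_algebra.
From mathcomp Require Import zify ring lra.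
From mathcomp Require Import boolp classical_sets.

(** The F-inequalities do not see the parabola j(n-j), because both
    (a+b)(c+d) + (a+c)(b+d) + (a+d)(b+c) and
    a(n-a) + b(n-b) + c(n-c) + d(n-d) equal twice the second elementary
    symmetric function of a, b, c, d. So a class r may be replaced by the
    function g(j) = r_j + (r_2/2) j(n-j) on {0, ..., n}, with g(0) = g(n) = 0,
    which is symmetric under j -> n-j. The factor r_2/2 makes g(2) = 2 g(1),
    and the form defining V_i is minus the second difference of g at i+1. Hence
    the F-simplex consists of the concave g, and V_1, ..., V_(k-2) require g to
    be linear on [0,k]. The extremal symmetric concave functions are the tents
    T_m(j) = min(m, j, n-j): the vertex p_m is the class of T_m
    ([tent_class_vertex]), and every class is a combination of tents whose
    coefficients are, up to a factor 1 or 2, its values under the forms of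
    the V_i ([tent_expansion]).

    F-nef classes lie in the F-simplex, whose inequalities are among the
    F-inequalities. So the elements of F_k are nonnegative combinations of
    T_k, ..., T_(n/2), and the first claim reduces to these tents being F-nef
    when 3k >= n ([tent_Fnef]). The bound is tight because T_k violates the
    F-inequality of (n-3k, k, k, k) as soon as 3k < n
    ([tent_class_not_Fnef]): its three positive terms are at most k each, while
    its negative terms are three times T_k(k) = k and a further positive
    number. *)

Set Implicit Arguments.
Unset Strict Implicit.
Unset Printing Implicit Defensive.

Import Order.TTheory GRing.Theory Num.Theory.

Local Open Scope classical_set_scope.
Local Open Scope ring_scope.

(** * Coordinates and the forms of the hyperplanes *)

Lemma coef_linear n j (c : rat) (r s : divClass n) :
  coef (c *: r + s) j = c * coef r j + coef s j.
Proof.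
rewrite /coef; case: minn => [|[|i]]; rewrite ?mulr0 ?addr0 //.
by case: insub => [l|] /=; rewrite ?mxE ?mulr0 ?addr0.
Qed.

Lemma Fform_is_linear n a b c d : scalar (@Fform n a b c d).
Proof. by move=> e r s; rewrite /Fform !coef_linear; ring. Qed.

HB.instance Definition _ n a b c d :=
  GRing.isLinear.Build rat (divClass n) rat _ (@Fform n a b c d)
    (@Fform_is_linear n a b c d).

Lemma Vform_is_linear n i : scalar (@Vform n i).
Proof. by move=> e r s; rewrite /Vform !coef_linear; ring. Qed.

HB.instance Definition _ n i :=
  GRing.isLinear.Build rat (divClass n) rat _ (@Vform n i)
    (@Vform_is_linear n i).

Lemma coef1 n (r : divClass n) : coef r 1 = 0.
Proof. by rewrite /coef; case: (minn 1 _) (geq_minl 1 (n - 1)) => [|[]]. Qed.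

Lemma coef_sym n (r : divClass n) j : (j <= n)%N -> coef r (n - j) = coef r j.
Proof. by move=> le_jn; rewrite /coef subKn // minnC. Qed.

Lemma coef_ord n (r : divClass n) (i : 'I_(n./2.-1)) : coef r i.+2 = r ord0 i.
Proof.
have ltih := ltn_ord i; rewrite /coef.
have -> : minn i.+2 (n - i.+2) = i.+2 by lia.
by rewrite valK.
Qed.

Lemma coef_row n (f : nat -> rat) j :
  f 1%N = 0 -> (forall l, (l <= n)%N -> f (n - l)%N = f l) -> (0 < j < n)%N ->
  coef (\row_(i < n./2.-1) f i.+2) j = f j.
Proof.
move=> f1 fsym.
have low l : (0 < l <= n./2)%N -> coef (\row_(i < n./2.-1) f i.+2) l = f l.
  case: l => [|[|l]] // hl; first by rewrite coef1 f1.
  have lt_l : (l < n./2.-1)%N by lia.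
  by rewrite (coef_ord _ (Ordinal lt_l)) mxE.
move=> hj; have [le_jh|gt_jh] := leqP j n./2; first by apply: low; lia.
have le_jn : (j <= n)%N by lia.
by rewrite -(coef_sym _ le_jn) -(fsym j le_jn) low //; lia.
Qed.

(** The equations [Vform i r = 0] say that the second differences of [coef r]
    all equal [coef r 2], so that [coef r j = coef r 2 * 'C(j, 2)] up to one
    step beyond the middle; this is compatible with the symmetry around n/2
    only if [coef r 2] vanishes. *)
Lemma Vform_inj n (r : divClass n) : (4 <= n)%N ->
  (forall i, (1 <= i <= n./2.-1)%N -> Vform i r = 0) -> r = 0.
Proof.
move=> n4 Vr.
have quad j : (j <= n./2)%N ->
    coef r j = coef r 2 * 'C(j, 2)%:R /\ coef r j.+1 = coef r 2 * 'C(j.+1, 2)%:R.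
  elim: j => [|j IHj] lt_j; first by rewrite coef1 /coef min0n !mulr0.
  have [rj rj1] := IHj (ltnW lt_j); split => //.
  case: j => [|j] in lt_j rj rj1 {IHj} *; first by rewrite binn mulr1.
  have hj : (1 <= j.+1 <= n./2.-1)%N by lia.
  have := Vr _ hj; rewrite /Vform rj rj1.
  rewrite !(binS _ 1) !bin1 !natrD -[j.+2%:R]natr1; lra.
have r2 : coef r 2 = 0.
  have [_ rh1] := quad n./2 (leqnn _).
  have le_reflected : (n - n./2.+1 <= n./2)%N by lia.
  have [rn _] := quad _ le_reflected.
  have lt_bin : ('C(n - n./2.+1, 2) < 'C(n./2.+1, 2))%N.
    by rewrite binS bin1; have := leq_bin2l 2 le_reflected; lia.
  move: rn; rewrite coef_sym ?rh1; last by lia.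
  move/eqP; rewrite -subr_eq0 -mulrBr mulf_eq0 subr_eq0 eqr_nat.
  by rewrite gtn_eqF // orbF => /eqP.
apply/rowP => i; rewrite mxE -coef_ord.
have [|_ ->] := quad i.+1; first by have := ltn_ord i; lia.
by rewrite r2 mul0r.
Qed.

(** * Tents *)

Definition tent n m j : nat := minn m (minn j (n - j)).

Lemma tentP n m j : [/\ (tent n m j <= m)%N, (tent n m j <= j)%N,
  (tent n m j <= n - j)%N
  & [\/ tent n m j = m, tent n m j = j | tent n m j = (n - j)%N]].
Proof.
rewrite /tent; case: (leqP j (n - j)) => ?; case: (leqP m) => ?; split; try lia.
all: by first [exact: Or31 | exact: Or32 | exact: Or33].
Qed.

Lemma tent_sym n m i j : (i + j = n)%N -> tent n m i = tent n m j.
Proof. by move=> ij; rewrite /tent -ij addKn addnK [minn i j]minnC. Qed.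

(** The class whose associated function g is the tent with break at m. The
    multiple of the parabola is the one that makes the coordinate r_1 vanish. *)
Definition tent_class n m : divClass n :=
  \row_i ((tent n m i.+2)%:R - (i.+2%:R * (n%:R - i.+2%:R)) / (n%:R - 1)).

Lemma coef_tent_class n m j : (0 < m)%N -> (0 < j < n)%N ->
  coef (tent_class n m) j = (tent n m j)%:R - (j%:R * (n%:R - j%:R)) / (n%:R - 1).
Proof.
move=> m0 hj.
have n1 : n%:R - 1 != 0 :> rat by rewrite subr_eq0 (eqr_nat _ n 1); lia.
rewrite -(@coef_row n (fun j => _ - j%:R * (n%:R - j%:R) / (n%:R - 1))) //.
  have -> : tent n m 1 = 1%N by rewrite /tent; lia.
  by field.
move=> l le_ln; rewrite natrB //; congr (_%:R - _ / _); last by ring.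
by rewrite /tent; lia.
Qed.

Lemma Fform_tent_class n m a b c d : (0 < m)%N ->
  (0 < a)%N -> (0 < b)%N -> (0 < c)%N -> (0 < d)%N -> (a + b + c + d = n)%N ->
  Fform a b c d (tent_class n m) =
  (tent n m (a + b) + tent n m (a + c) + tent n m (a + d))%:R
  - (tent n m a + tent n m b + tent n m c + tent n m d)%:R.
Proof.
move=> m0 a0 b0 c0 d0 abcd.
have n1 : n%:R - 1 != 0 :> rat by rewrite subr_eq0 (eqr_nat _ n 1); lia.
rewrite /Fform !coef_tent_class //; try lia.
rewrite !natrD; move: n1; rewrite -abcd !natrD => n1; field.
exact: n1.
Qed.

(** Minus the second difference of the tent at its break m: when m is the
    middle of [0,n], the two slopes 1 and -1 meet there. *)
Definition kink n m : nat := if m.*2 == n then 2 else 1.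

(** A tent is affine on both sides of its break in the left half, so only one of
    the forms is nonzero on its class. *)
Lemma Vform_tent_class n m i :
  (2 <= m <= n./2)%N -> (1 <= i <= n./2.-1)%N ->
  Vform i (tent_class n m) = if i.+1 == m then (kink n m)%:R else 0.
Proof.
move=> hm hi; rewrite VformE // Fform_tent_class; try lia.
suff -> : (tent n m (1 + 1) + tent n m (1 + i) + tent n m (1 + (n - i - 2)))%N
        = ((if i.+1 == m then kink n m else 0)
           + (tent n m 1 + tent n m 1 + tent n m i + tent n m (n - i - 2)))%N.
  by rewrite natrD addrK; case: ifP.
rewrite (@tent_sym _ _ (1 + (n - i - 2))%N i.+1); last by lia.
(* All arguments but possibly i + 2, the reflection of n - i - 2, lie in the
   left half, where the tent is min(m, j). *)
have low j : (j <= n./2)%N -> tent n m j = minn m j.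
  by move=> le_jh; rewrite /tent (minn_idPl (_ : j <= n - j)%N) //; lia.
rewrite !add1n (low 2) ?(low i.+1) ?(low 1) ?(low i); try lia.
have := tentP n m (n - i - 2); rewrite /kink => -[t1 t2 t3 t4].
have [lt_mi|] := ltnP m i.+1; last rewrite leq_eqVlt => /orP[/eqP e_mi|lt_im].
- by rewrite gtn_eqF //; case: t4; lia.
- by rewrite e_mi eqxx; case: eqP; case: t4; lia.
- by rewrite ltn_eqF //; case: t4; lia.
Qed.

(** By [Vform_tent_class] the tents form, up to scaling, the dual basis of the
    forms [Vform i]; [Vform_inj] shows that they span. *)
Lemma tent_expansion n (r : divClass n) : (4 <= n)%N ->
  r = \sum_(l < n./2.-1)
        (Vform l.+1 r / (kink n l.+2)%:R) *: tent_class n l.+2.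
Proof.
move=> n4; apply/eqP; rewrite -subr_eq0; apply/eqP/Vform_inj => // i hi.
rewrite linearB linear_sum /=.
have lt_i : (i.-1 < n./2.-1)%N by lia.
rewrite (bigD1 (Ordinal lt_i)) //= big1 => [|l ne_l].
  rewrite addr0 linearZ /= Vform_tent_class //; try lia.
  have -> : i.-1.+1 = i by lia.
  by rewrite eqxx divfK ?subrr // /kink; case: ifP.
rewrite linearZ /= Vform_tent_class //; last by have := ltn_ord l; lia.
case: eqP => [e|]; last by rewrite /= mulr0.
by case/eqP: ne_l; apply: val_inj => /=; lia.
Qed.

(** * Which tents are F-nef *)

Lemma tent_concave n m x y z w : (x <= y)%N -> (x <= z)%N -> (w <= n)%N ->
  (x + w = y + z)%N -> (tent n m x + tent n m w <= tent n m y + tent n m z)%N.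
Proof.
have [x1 x2 x3 _] := tentP n m x; have [w1 w2 w3 _] := tentP n m w.
have [_ _ _ y4] := tentP n m y; have [_ _ _ z4] := tentP n m z.
move=> *; case: y4; case: z4; lia.
Qed.

(** When the tent is the identity at a + b, it satisfies
    T(a) + T(b) <= T(a+b); the rest of the inequality is concavity for
    c <= a+c, b+c <= a+b+c, since d and a+b+c, as well as a+d and b+c, are
    exchanged by the symmetry. *)
Lemma tent_Fnef_small n m a b c d : (a + b + c + d = n)%N ->
  tent n m (a + b) = (a + b)%N ->
  (tent n m a + tent n m b + tent n m c + tent n m d
     <= tent n m (a + b) + tent n m (a + c) + tent n m (a + d))%N.
Proof.
move=> abcd ->; rewrite (@tent_sym _ _ d (a + b + c)%N); last by lia.
rewrite (@tent_sym _ _ (a + d)%N (b + c)%N); last by lia.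
have [_ ha _ _] := tentP n m a; have [_ hb _ _] := tentP n m b.
have := @tent_concave n m c (a + c) (b + c) (a + b + c).
by lia.
Qed.

(** If all three pair sums reach the plateau, the right-hand side is 3m, which
    is at least n = a + b + c + d. Otherwise the tent is the identity at some
    pair sum, or at the complementary one, and [tent_Fnef_small] applies after
    a permutation of a, b, c, d. *)
Lemma tent_Fnef n m a b c d : (n <= 3 * m)%N -> (a + b + c + d = n)%N ->
  (tent n m a + tent n m b + tent n m c + tent n m d
     <= tent n m (a + b) + tent n m (a + c) + tent n m (a + d))%N.
Proof.
move=> nm abcd.
have sab : tent n m (c + d) = tent n m (a + b) by apply: tent_sym; lia.
have sac : tent n m (b + d) = tent n m (a + c) by apply: tent_sym; lia.
have sad : tent n m (b + c) = tent n m (a + d) by apply: tent_sym; lia.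
have [_ _ _ [eab|eab|eab]] := tentP n m (a + b); last 2 first.
- exact: tent_Fnef_small.
- have := @tent_Fnef_small n m c d a b.
  by rewrite (addnC c a) (addnC c b) sab sad; lia.
have [_ _ _ [eac|eac|eac]] := tentP n m (a + c); last 2 first.
- by have := @tent_Fnef_small n m a c b d; lia.
- have := @tent_Fnef_small n m b d a c.
  by rewrite (addnC b a) sac sad; lia.
have [_ _ _ [ead|ead|ead]] := tentP n m (a + d); last 2 first.
- by have := @tent_Fnef_small n m a d b c; lia.
- have := @tent_Fnef_small n m b c a d.
  by rewrite (addnC b a) sac sad; lia.
have [_ ha _ _] := tentP n m a; have [_ hb _ _] := tentP n m b.
have [_ hc _ _] := tentP n m c; have [_ hd _ _] := tentP n m d.
by lia.
Qed.

(** * Vertices of the F-simplex *)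

Lemma line_colinear n (L : W n) (r s : divClass n) :
  r != 0 -> r \in line L -> s \in line L -> exists c, s = c *: r.
Proof.
move=> r0 rL sL; suff eL : line L = <[r]>%VS by apply/vlineP; rewrite -eL.
apply/esym/eqP; rewrite eqEdim -memvE rL dim_vline r0.
by rewrite /line (eqP (svalP L)).
Qed.

Lemma V_line n i (L : W n) r : V n i L -> r \in line L -> Vform i r = 0.
Proof.
move=> [s [/= Vs s0 sL]] rL; have [c ->] := line_colinear s0 sL rL.
by rewrite linearZ /= Vs mulr0.
Qed.

Lemma span_subproof n (r : divClass n) : r != 0 -> \dim <[r]>%VS == 1%N.
Proof. by move=> r0; rewrite dim_vline r0. Qed.

Definition line_through n (r : divClass n) (r0 : r != 0) : W n :=
  exist _ <[r]>%VS (span_subproof r0).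

Lemma mem_line_through n (r : divClass n) (r0 : r != 0) :
  r \in line (line_through r0).
Proof. exact: memv_line. Qed.

Lemma Fcone_simplex n r : Fcone n r -> Fsimplex_cone n r.
Proof. by move=> Fr i hi; rewrite VformE //; apply: Fr; lia. Qed.

Lemma kink_gt0 n m : 0 < (kink n m)%:R :> rat.
Proof. by rewrite ltr0n /kink; case: ifP. Qed.

Lemma tent_class_neq0 n m : (2 <= m <= n./2)%N -> tent_class n m != 0.
Proof.
move=> hm; have hm1 : (1 <= m.-1 <= n./2.-1)%N by lia.
have := Vform_tent_class hm hm1; rewrite prednK ?eqxx; last by lia.
move=> e; apply/eqP => t0; move: (kink_gt0 n m).
by rewrite -e t0 linear0 ltxx.
Qed.

Lemma tent_class_simplex n m : (2 <= m <= n./2)%N ->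
  Fsimplex_cone n (tent_class n m).
Proof. by move=> hm i hi; rewrite Vform_tent_class //; case: ifP. Qed.

Lemma tent_class_vertex n m (hm : (2 <= m <= n./2)%N) :
  vertex n m (line_through (tent_class_neq0 hm)).
Proof.
move=> i /= [hi ne_im]; exists (tent_class n m).
split; [|exact: tent_class_neq0|exact: mem_line_through].
by rewrite /= Vform_tent_class //; case: eqP => // e; case: ne_im; lia.
Qed.

(** On the line of p_m all terms of [tent_expansion] vanish except the one of
    the tent with break at m. *)
Lemma vertex_multiple n m (L : W n) r : (4 <= n)%N -> (2 <= m <= n./2)%N ->
  vertex n m L -> r \in line L ->
  r = (Vform m.-1 r / (kink n m)%:R) *: tent_class n m.
Proof.
move=> n4 hm vL rL; have lt_m : (m - 2 < n./2.-1)%N by lia.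
rewrite {1}(tent_expansion r n4) (bigD1 (Ordinal lt_m)) //= big1.
  by rewrite addr0; congr (Vform _ _ / (kink n _)%:R *: tent_class n _); lia.
move=> l ne_l; have hl := ltn_ord l.
rewrite (@V_line _ _ L r) ?mul0r ?scale0r //; apply: vL; split; first by lia.
by move=> e; case/eqP: ne_l; apply: val_inj => /=; lia.
Qed.

(** * Comparison of F_k with the face *)

Lemma tent_class_Fnef n m : (0 < m)%N -> (n <= 3 * m)%N ->
  Fcone n (tent_class n m).
Proof.
move=> m0 nm a b c d a0 b0 c0 d0 abcd.
by rewrite Fform_tent_class // subr_ge0 ler_nat tent_Fnef.
Qed.

Lemma tent_class_not_Fnef n m : (0 < m)%N -> (3 * m < n)%N ->
  ~ Fcone n (tent_class n m).
Proof.
move=> m0 mn /(_ (n - 3 * m)%N m m m).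
rewrite Fform_tent_class ?subr_ge0 ?ler_nat; try lia.
have tm : tent n m m = m by rewrite /tent; lia.
have [t1 _ _ _] := tentP n m (n - 3 * m + m).
have t0 : (0 < tent n m (n - 3 * m))%N by rewrite /tent; lia.
by rewrite tm => /(_ _ _ _ _ _)/wrap[]; lia.
Qed.

Lemma third_le n k : (n%:R / 3 <= k%:R :> rat) = (n <= 3 * k)%N.
Proof. by rewrite ler_pdivrMr // -natrM ler_nat mulnC. Qed.

Lemma F_face n k : (4 <= n)%N -> (2 <= k <= n./2)%N -> (n <= 3 * k)%N ->
  F_ n k = Fsimplex_face n k.
Proof.
move=> n4 hk nk; apply/seteqP; split=> L.
  move=> [VL [r [Fr r0 rL]]]; exists r; split=> //.
  (* The terms of the expansion with break below k vanish; their tents are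
     replaced by the one with break at k, so that all of them are generators. *)
  pose m (l : 'I_(n./2.-1)) := maxn k l.+2.
  exists n./2.-1, (fun l => Vform l.+1 r / (kink n l.+2)%:R),
    (fun l => tent_class n (m l)); split.
  - move=> l; have := ltn_ord l => hl.
    by rewrite divr_ge0 // (Fcone_simplex Fr); lia.
  - move=> l; have hm : (2 <= m l <= n./2)%N.
      by have := ltn_ord l; rewrite /m; lia.
    split; first exact: tent_class_simplex.
    exists (line_through (tent_class_neq0 hm)); last exact: mem_line_through.
    exists (m l); last exact: tent_class_vertex.
    by have := ltn_ord l; rewrite /= /m; lia.
  rewrite {1}(tent_expansion r n4); apply: eq_bigr => l _.
  have [/maxn_idPr ml | lt_lk] := leqP k l.+2; first by rewrite /m ml.
  rewrite (@V_line _ _ L r) ?mul0r ?scale0r //.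
  by apply: VL => /=; lia.
move=> [r [[p [c [v [c0 Av rE]]]] r0 rL]].
have {}Av l : exists j e,
    [/\ (k <= j <= n./2)%N, 0 <= e & v l = e *: tent_class n j].
  have [Sv [L' [j /= hj vL'] vl]] := Av l.
  have hj2 : (2 <= j <= n./2)%N by lia.
  exists j, (Vform j.-1 (v l) / (kink n j)%:R); split=> //.
    by rewrite divr_ge0 // Sv; lia.
  exact: vertex_multiple vL' vl.
split.
  move=> i /= hi; exists r; split=> //=.
  rewrite rE linear_sum big1 // => l _.
  have [j [e [hj _ ->]]] := Av l.
  rewrite !linearZ /= Vform_tent_class; try lia.
  by rewrite ltn_eqF ?mulr0 //; lia.
exists r; split=> // a b c' d a0 b0 c'0 d0 abcd.
rewrite rE linear_sum sumr_ge0 // => l _.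
have [j [e [hj e0 ->]]] := Av l.
rewrite !linearZ /= !mulr_ge0 //.
by apply: tent_class_Fnef => //; lia.
Qed.

Lemma F_not_face n k : (4 <= n)%N -> (2 <= k)%N -> (3 * k < n)%N ->
  F_ n k <> Fsimplex_face n k.
Proof.
move=> n4 k2 kn FE; have hk : (2 <= k <= n./2)%N by lia.
pose L := line_through (tent_class_neq0 hk).
have : Fsimplex_face n k L.
  exists (tent_class n k).
  split; [|exact: tent_class_neq0|exact: mem_line_through].
  exists 1%N, (fun=> 1), (fun=> tent_class n k); split=> [//|_|].
    split; first exact: tent_class_simplex.
    exists L; last exact: mem_line_through.
    by exists k; [rewrite /=; lia|exact: tent_class_vertex].
  by rewrite big_ord1 scale1r.
rewrite -FE => -[_ [r [Fr r0 /vlineP[e rE]]]].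
have hk1 : (1 <= k.-1 <= n./2.-1)%N by lia.
(* A line meets a cone in either of its two directions: the opposite of the
   tent class is excluded because F-nef classes lie in the F-simplex. *)
have e0 : 0 < e.
  rewrite lt0r; apply/andP; split.
    by apply: contraNneq r0 => e0; rewrite rE e0 scale0r.
  have := Fcone_simplex Fr hk1; rewrite rE linearZ /= Vform_tent_class //.
  by rewrite prednK ?eqxx ?pmulr_lge0 ?kink_gt0 //; lia.
apply: (@tent_class_not_Fnef n k); [lia..|].
move=> a b c d a0 b0 c0 d0 abcd; have := Fr a b c d a0 b0 c0 d0 abcd.
by rewrite rE linearZ /= pmulr_rge0.
Qed.

Theorem theorem6p6 :
  (forall n k : nat,
     (4 <= n)%N -> (2 <= k <= n./2)%N ->
     (n%:R / 3 <= k%:R :> rat)%R ->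
     F_ n k = Fsimplex_face n k)
  /\
  (forall n k : nat,
     (7 <= n)%N ->
     (k%:R < n%:R / 3 :> rat)%R ->
     (forall j : nat, (j%:R < n%:R / 3 :> rat)%R -> (j <= k)%N) ->
     F_ n k <> Fsimplex_face n k).
Proof.
split=> n k hn; first by move=> hk; rewrite third_le; apply: F_face.
(* As 2 < n/3, the largest k below n/3 is at least 2. *)
rewrite ltNge third_le -ltnNge => kn /(_ 2); rewrite ltNge third_le -ltnNge => k2.
by apply: F_not_face => //; [lia | apply: k2; lia].
Qed.
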